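(* Fix $\Delta x,\Delta y,\Delta t>0$ and fix the discrete data at time $t_n$ (cell distribution functions $f_{i,j}^n$, their slopes $\delta_xf_{i,j}^n$, positive macroscopic states, bounded opacities). Put $\eta=\epsilon$ and let $\epsilon\to0$. Depending on the variables used to reconstruct the Maxwellian, the macroscopic UGKS fluxes have the following limits. (i) If the Maxwellian slopes are computed with the variables $\mathbf{Z}=(\rho,T)^T$, then $$\Phi^\rho_{i+1/2,j}\longrightarrow-\frac{1}{\sigma_{i+1/2,j}}\left[T_{i+1/2,j}^n\frac{\rho_{i+1,j}^n-\rho_{i,j}^n}{\Delta x}+\rho_{i+1/2,j}^n\frac{T_{i+1,j}^n-T_{i,j}^n}{\Delta x}\right],$$ $$\Phi^q_{i+1/2,j}\longrightarrow-\frac{5}{2\sigma_{i+1/2,j}}\left((T_{i+1/2,j}^n)^2\frac{\rho_{i+1,j}^n-\rho_{i,j}^n}{\Delta x}+2\rho_{i+1/2,j}^nT_{i+1/2,j}^n\frac{T_{i+1,j}^n-T_{i,j}^n}{\Delta x}\right).$$ (ii) If the Maxwellian slopes are computed with the variables $\mathbf{Y}=(q,y)^T$, $y=q^2/\rho$, then $$\Phi^\rho_{i+1/2,j}\longrightarrow-\frac{2}{3\sigma_{i+1/2,j}}\,\frac{q_{i+1,j}^n-q_{i,j}^n}{\Delta x},\qquad \Phi^q_{i+1/2,j}\longrightarrow-\frac53\,\frac{2}{3\sigma_{i+1/2,j}}\,\frac{y_{i+1,j}^n-y_{i,j}^n}{\Delta x}.$$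
   Context: Notation: $\mathbb{S}^2$ is the unit sphere of $\mathbb{R}^3$, $v\in\mathbb{R}_+$ the speed, $\boldsymbol\Omega=(\Omega_x,\Omega_y,\Omega_z)\in\mathbb{S}^2$ the direction; $\langle\langle g\rangle\rangle=\int_{\mathbb{S}^2}\int_{\mathbb{R}_+}g\,v^2\,dv\,d\Omega$; $\boldsymbol\Psi(v)=(1,\frac12v^2)^T$. The electron transport equation is $\partial_t f+\frac{v}{\eta}\boldsymbol\Omega\cdot\nabla_{\mathbf{x}}f=\nu(M[f]-f)$ with $\nu=\frac{\sigma}{\epsilon\eta}$, where $\sigma=C\rho/T^{3/2}$ ($C>0$ constant) is the opacity, $q=\frac32\rho T$, and the Maxwellian is $M(v)=\frac{\rho}{(2\pi T)^{3/2}}e^{-v^2/(2T)}$. The Maxwellian may be regarded as a function $M[\mathbf{X}]$ of any set of variables $\mathbf{X}$ determining $(\rho,T)$, here $\mathbf{X}=\mathbf{Z}=(\rho,T)^T$ or $\mathbf{X}=\mathbf{Y}=(q,y)^T$ with $y=q^2/\rho$. Cells $C_{i,j}$ have size $\Delta x\times\Delta y$. The interface state is the arithmetic mean of the chosen variables, $\mathbf{X}_{i+1/2,j}^n=\frac12(\mathbf{X}_{i,j}^n+\mathbf{X}_{i+1,j}^n)$; in case (i) its components are $\rho_{i+1/2,j}^n,T_{i+1/2,j}^n$. Also $\sigma_{i+1/2,j}=\frac12(\sigma_{i,j}+\sigma_{i+1,j})>0$, $f_{i,j}^{n(\pm)}=f_{i,j}^n\pm\frac{\Delta x}{2}\delta_xf_{i,j}^n$.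 With variables $\mathbf{X}$, the Maxwellian slopes are given by the chain rule: $$\delta_x^LM_{i+1/2,j}^n=\frac{\partial M}{\partial\mathbf{X}}[\mathbf{X}_{i+1/2,j}^n]\cdot\frac{\mathbf{X}_{i+1/2,j}^n-\mathbf{X}_{i,j}^n}{\Delta x/2},\qquad \delta_x^RM_{i+1/2,j}^n=\frac{\partial M}{\partial\mathbf{X}}[\mathbf{X}_{i+1/2,j}^n]\cdot\frac{\mathbf{X}_{i+1,j}^n-\mathbf{X}_{i+1/2,j}^n}{\Delta x/2}.$$ The UGKS microscopic flux at the interface $(i+1/2,j)$ is $$\phi_{i+1/2,j}=A\,v\Omega_x\big(f_{i,j}^{n(+)}\mathbb{1}_{\Omega_x>0}+f_{i+1,j}^{n(-)}\mathbb{1}_{\Omega_x<0}\big)+B\,v^2\Omega_x^2\big(\delta_xf_{i,j}^n\mathbb{1}_{\Omega_x>0}+\delta_xf_{i+1,j}^n\mathbb{1}_{\Omega_x<0}\big)+C_0\,v\Omega_xM[\mathbf{X}_{i+1/2,j}^n]+D\,v^2\Omega_x^2\big(\delta_x^LM_{i+1/2,j}^n\mathbb{1}_{\Omega_x>0}+\delta_x^RM_{i+1/2,j}^n\mathbb{1}_{\Omega_x<0}\big),$$ where, with $w=-\frac{\sigma_{i+1/2,j}}{\epsilon\eta}\Delta t$, $$A=-\frac1\eta\frac{1-e^w}{w},\quad B=\frac{\epsilon}{\sigma_{i+1/2,j}\eta}\Big(e^w+\frac{1-e^w}{w}\Big),\quad C_0=\frac1\eta\Big(1+\frac{1-e^w}{w}\Big),\quad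 D=-\frac{\epsilon}{\sigma_{i+1/2,j}\eta}\Big(1+e^w+2\frac{1-e^w}{w}\Big).$$ The macroscopic fluxes are $(\Phi^\rho_{i+1/2,j},\Phi^q_{i+1/2,j})^T=\langle\langle\boldsymbol\Psi\,\phi_{i+1/2,j}\rangle\rangle$; all velocity moments of $f_{i,j}^n$ and $\delta_xf_{i,j}^n$ appearing in them are assumed finite. *)

(* Defs.v *)
From HB Require Import structures.
From mathcomp Require Import all_boot all_order all_algebra.
From mathcomp Require Import all_classical all_reals all_analysis.
From mathcomp Require Import measurable_realfun.

Set Implicit Arguments.
Unset Strict Implicit.
Unset Printing Implicit Defensive.

Import Order.TTheory GRing.Theory Num.Theory.
Import numFieldNormedType.Exports.

Local Open Scope classical_set_scope.
Local Open Scope ring_scope.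

Notation space3 R := (R * R * R)%type.

Definition xcomp {R : realType} (x : space3 R) : R := x.1.1.

Definition sphere (R : realType) : set (space3 R) :=
  [set x | x.1.1 ^+ 2 + x.1.2 ^+ 2 + x.2 ^+ 2 = 1].
Arguments sphere : clear implicits.

(* (colatitude, azimuth) |-> direction *)
Definition direction {R : realType} (a : R * R) : space3 R :=
  (sin a.1 * cos a.2, sin a.1 * sin a.2, cos a.1).

Definition angles (R : realType) : set (R * R) :=
  `[0, pi] `*` `[0, pi *+ 2].
Arguments angles : clear implicits.

(* The measure sin theta dtheta dphi on the domain of the angles. *)
Definition angle_measure (R : realType) (A : set (R * R)) : \bar R :=
  (\int[lebesgue_measure \x lebesgue_measure]_(a in A `&` angles R)
     (sin a.1)%:E)%E.

Section angle_measure.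
Context {R : realType}.
Local Notation mu := (@lebesgue_measure R).

Lemma measurable_sphere : measurable (sphere R).
Proof.
have m1 : measurable_fun [set: space3 R] (fun x : space3 R => x.1.1).
  exact: (measurableT_comp measurable_fst measurable_fst).
have m2 : measurable_fun [set: space3 R] (fun x : space3 R => x.1.2).
  exact: (measurableT_comp measurable_snd measurable_fst).
have m3 : measurable_fun [set: space3 R] (fun x : space3 R => x.2).
  exact: measurable_snd.
have mf : measurable_fun [set: space3 R]
    (fun x : space3 R => x.1.1 ^+ 2 + x.1.2 ^+ 2 + x.2 ^+ 2).
  by apply: measurable_funD; [apply: measurable_funD|];
    exact: measurable_funX.
have := mf measurableT [set 1] (measurable_set1 1).
by rewrite setTI.
Qed.

Lemma measurable_angles : measurable (angles R).
Proof. by apply: measurableX; exact: measurable_itv. Qed.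

Lemma measurable_sin1 (D : set (R * R)) :
  measurable_fun D (fun a : R * R => sin a.1).
Proof.
apply: (@measurable_funS _ _ _ _ setT) => //.
apply: measurableT_comp measurable_fst.
by apply: continuous_measurable_fun; exact: continuous_sin.
Qed.

Lemma measurable_direction : measurable_fun setT (@direction R).
Proof.
have ms : measurable_fun setT (@sin R).
  by apply: continuous_measurable_fun; exact: continuous_sin.
have mc : measurable_fun setT (@cos R).
  by apply: continuous_measurable_fun; exact: continuous_cos.
have f1 : measurable_fun [set: R * R] fst by exact: measurable_fst.
have f2 : measurable_fun [set: R * R] snd by exact: measurable_snd.
apply: measurable_fun_pair; last exact: (measurableT_comp mc f1).
apply: measurable_fun_pair; apply: measurable_funM.
- exact: (measurableT_comp ms f1).
- exact: (measurableT_comp mc f2).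
- exact: (measurableT_comp ms f1).
- exact: (measurableT_comp ms f2).
Qed.

Lemma sphere_direction (a : R * R) : sphere R (direction a).
Proof.
rewrite /sphere /= !exprMn -mulrDr cos2Dsin2 mulr1.
by rewrite addrC cos2Dsin2.
Qed.

Let sin_ge0 (a : R * R) : angles R a -> (0 <= (sin a.1)%:E)%E.
Proof.
by case => /= + _; rewrite in_itv /= => a1; rewrite lee_fin sin_ge0_pi.
Qed.

Let angle0 : angle_measure (@set0 (R * R)) = 0%E.
Proof. by rewrite /angle_measure set0I integral_set0. Qed.

Let angle_ge0 (A : set (R * R)) : (0 <= angle_measure A)%E.
Proof. by apply: integral_ge0 => a [_ /sin_ge0]. Qed.

Let angle_sigma_additive : semi_sigma_additive (@angle_measure R).
Proof.
move=> F mF tF mUF; rewrite /angle_measure setI_bigcupl.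
rewrite ge0_integral_bigcup.
- apply: is_cvg_ereal_nneg_natsum_cond => n _ _.
  by apply: integral_ge0 => a [_ /sin_ge0].
- by move=> k; apply: measurableI; [exact: mF|exact: measurable_angles].
- by apply/measurable_EFinP; exact: measurable_sin1.
- by move=> a [k _ [_ /sin_ge0]].
- exact: trivIset_setIr.
Qed.

HB.instance Definition _ := isMeasure.Build _ _ _
  (@angle_measure R) angle0 angle_ge0 angle_sigma_additive.

Lemma fin_num_angle_measure : fin_num_fun (@angle_measure R).
Proof.
move=> A mA; rewrite ge0_fin_numE ?angle_ge0//.
have mAD : measurable (A `&` angles R).
  by apply: measurableI => //; exact: measurable_angles.
apply: (@le_lt_trans _ _ (\int[mu \x mu]_(a in A `&` angles R) 1)%E).
  apply: ge0_le_integral => //.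
  - by move=> a [_ /sin_ge0].
  - by apply/measurable_EFinP; exact: measurable_sin1.
  - by move=> a _; rewrite lee_fin sin_le1.
rewrite integral_cst// mul1e.
apply: (@le_lt_trans _ _ ((mu \x mu)%E (angles R))).
  apply: le_measure; rewrite ?inE//; exact: measurable_angles.
rewrite /angles product_measure1E//=.
rewrite !lebesgue_measure_itv /= !lte_fin; do 2 case: ifP => _;
  by rewrite -?EFinB -?EFinM ?mul0e ?mule0 -?EFinM ltry.
Qed.

HB.instance Definition _ :=
  @Measure_isFinite.Build _ _ R (@angle_measure R) fin_num_angle_measure.

End angle_measure.

(* The surface measure dOmega, as a measure on R^3 concentrated on the
   sphere. *)
Definition sphere_measure (R : realType) : set (space3 R) -> \bar R :=
  pushforward (@angle_measure R) direction.

Section sphere_measure.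
Context {R : realType}.

Let sphere0 : @sphere_measure R set0 = 0%E.
Proof. by rewrite /sphere_measure /pushforward preimage_set0 measure0. Qed.

Let sphere_ge0 A : (0 <= @sphere_measure R A)%E.
Proof. exact: (measure_ge0 (@angle_measure R)). Qed.

Let sphere_sigma_additive : semi_sigma_additive (@sphere_measure R).
Proof.
pose h := measurable_direction (R := R).
move=> F mF tF mUF.
rewrite /sphere_measure /pushforward preimage_bigcup.
apply: measure_semi_sigma_additive.
- by move=> n; rewrite -[X in measurable X]setTI; exact: h.
- apply/trivIsetP => /= i j _ _ ij; rewrite -preimage_setI.
  by move/trivIsetP : tF => /(_ _ _ _ _ ij) ->//; rewrite preimage_set0.
- by rewrite -preimage_bigcup -[X in measurable X]setTI; exact: h.
Qed.

HB.instance Definition _ := isMeasure.Build _ _ _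
  (@sphere_measure R) sphere0 sphere_ge0 sphere_sigma_additive.

Lemma fin_num_sphere_measure : fin_num_fun (@sphere_measure R).
Proof.
move=> A mA; rewrite /sphere_measure /pushforward; apply: fin_num_measure.
rewrite -[X in measurable X]setTI.
exact: (measurable_direction (R := R)).
Qed.

HB.instance Definition _ :=
  @Measure_isFinite.Build _ _ R (@sphere_measure R) fin_num_sphere_measure.

End sphere_measure.

Section kinetic.
Context {R : realType}.

Definition velocity_domain : set (R * space3 R) := `[0, +oo[ `*` sphere R.

Definition moment_integrand (g : R -> space3 R -> R) (u : R * space3 R) : R :=
  g u.1 u.2 * u.1 ^+ 2.

(* <<g>>, the integral of g(v, Omega) v^2 dv dOmega over R_+ x S^2. *)
Definition moment (g : R -> space3 R -> R) : R :=
  \int[(lebesgue_measure \x @sphere_measure R)%E]_(u in velocity_domain)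
    moment_integrand g u.

Definition finite_moment (g : R -> space3 R -> R) : Prop :=
  (lebesgue_measure \x @sphere_measure R)%E.-integrable velocity_domain
    (EFin \o moment_integrand g).

Definition Psi (v : R) : R * R := (1, v ^+ 2 / 2).

Definition moments (g : R -> space3 R -> R) : R * R :=
  (moment (fun v Omega => (Psi v).1 * g v Omega),
   moment (fun v Omega => (Psi v).2 * g v Omega)).

Definition finite_moments (g : R -> space3 R -> R) : Prop :=
  finite_moment (fun v Omega => (Psi v).1 * g v Omega) /\
  finite_moment (fun v Omega => (Psi v).2 * g v Omega).

Definition energy (rho T : R) : R := 3 / 2 * rho * T.

(* M[Z] with Z = (rho, T). *)
Definition maxwellian_Z (Z : R * R) (v : R) : R :=
  Z.1 / (2 * pi * Z.2) `^ (3 / 2) * expR (- v ^+ 2 / (2 * Z.2)).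

Definition vars_Y (rho T : R) : R * R :=
  (energy rho T, energy rho T ^+ 2 / rho).

(* The (rho, T) determined by Y = (q, y): rho = q^2 / y, T = 2 q / (3 rho). *)
Definition vars_Z_of_Y (Y : R * R) : R * R :=
  let rho := Y.1 ^+ 2 / Y.2 in (rho, 2 * Y.1 / (3 * rho)).

(* M[Y] with Y = (q, y). *)
Definition maxwellian_Y (Y : R * R) (v : R) : R :=
  maxwellian_Z (vars_Z_of_Y Y) v.

(* dM/dX[X] . h *)
Definition chain_rule (M : R * R -> R -> R) (X h : R * R) (v : R) : R :=
  derive1 (fun a => M (a, X.2) v) X.1 * h.1 +
  derive1 (fun b => M (X.1, b) v) X.2 * h.2.

Definition mean (a b : R) : R := (a + b) / 2.

(* Value at the interface (i + 1/2, j) of a cell quantity. *)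
Definition interface (a : int -> int -> R) (i j : int) : R :=
  mean (a i j) (a (i + 1) j).

Definition interface2 (X : int -> int -> R * R) (i j : int) : R * R :=
  (interface (fun k l => (X k l).1) i j, interface (fun k l => (X k l).2) i j).

Definition difference_quotient (X X' : R * R) (h : R) : R * R :=
  ((X'.1 - X.1) / h, (X'.2 - X.2) / h).

Definition slopeL (M : R * R -> R -> R) (X : int -> int -> R * R) (dx : R)
    (i j : int) (v : R) : R :=
  chain_rule M (interface2 X i j)
    (difference_quotient (X i j) (interface2 X i j) (dx / 2)) v.

Definition slopeR (M : R * R -> R -> R) (X : int -> int -> R * R) (dx : R)
    (i j : int) (v : R) : R :=
  chain_rule M (interface2 X i j)
    (difference_quotient (interface2 X i j) (X (i + 1) j) (dx / 2)) v.

(* In the coefficients, s is the opacity at the interface. *)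
Definition ugks_w (eps eta s dt : R) : R := - (s / (eps * eta)) * dt.

Definition ugks_A (eps eta s dt : R) : R :=
  let w := ugks_w eps eta s dt in
  - (1 / eta) * ((1 - expR w) / w).

Definition ugks_B (eps eta s dt : R) : R :=
  let w := ugks_w eps eta s dt in
  eps / (s * eta) * (expR w + (1 - expR w) / w).

Definition ugks_C (eps eta s dt : R) : R :=
  let w := ugks_w eps eta s dt in
  1 / eta * (1 + (1 - expR w) / w).

Definition ugks_D (eps eta s dt : R) : R :=
  let w := ugks_w eps eta s dt in
  - (eps / (s * eta)) * (1 + expR w + 2 * ((1 - expR w) / w)).

Definition ind_pos (Omega : space3 R) : R := \1_[set x | 0 < xcomp x] Omega.
Definition ind_neg (Omega : space3 R) : R := \1_[set x | xcomp x < 0] Omega.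

(* f and df are the cell values and slopes of the distribution function. *)
Definition micro_flux (eps eta dx dt : R) (f df : int -> int -> R -> space3 R -> R)
    (sigma : int -> int -> R) (M : R * R -> R -> R) (X : int -> int -> R * R)
    (i j : int) (v : R) (Omega : space3 R) : R :=
  let s := interface sigma i j in
  let fL := f i j v Omega + dx / 2 * df i j v Omega in
  let fR := f (i + 1) j v Omega - dx / 2 * df (i + 1) j v Omega in
  let vx := v * xcomp Omega in
  ugks_A eps eta s dt * vx * (fL * ind_pos Omega + fR * ind_neg Omega) +
  ugks_B eps eta s dt * vx ^+ 2 *
    (df i j v Omega * ind_pos Omega + df (i + 1) j v Omega * ind_neg Omega) +
  ugks_C eps eta s dt * vx * M (interface2 X i j) v +
  ugks_D eps eta s dt * vx ^+ 2 *
    (slopeL M X dx i j v * ind_pos Omega + slopeR M X dx i j v * ind_neg Omega).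

(* (Phi^rho, Phi^q) at the interface (i + 1/2, j). *)
Definition macro_flux (eps eta dx dt : R) (f df : int -> int -> R -> space3 R -> R)
    (sigma : int -> int -> R) (M : R * R -> R -> R) (X : int -> int -> R * R)
    (i j : int) : R * R :=
  moments (micro_flux eps eta dx dt f df sigma M X i j).

(* Finiteness of the moments of f and df that enter the macroscopic fluxes. *)
Definition finite_flux_moments (f df : int -> int -> R -> space3 R -> R)
    (i j : int) : Prop :=
  [/\ finite_moments (fun v Omega =>
        v * xcomp Omega * f i j v Omega * ind_pos Omega) /\
      finite_moments (fun v Omega =>
        v * xcomp Omega * f (i + 1) j v Omega * ind_neg Omega),
      finite_moments (fun v Omega =>
        v * xcomp Omega * df i j v Omega * ind_pos Omega) /\
      finite_moments (fun v Omega =>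
        v * xcomp Omega * df (i + 1) j v Omega * ind_neg Omega) &
      finite_moments (fun v Omega =>
        (v * xcomp Omega) ^+ 2 * df i j v Omega * ind_pos Omega) /\
      finite_moments (fun v Omega =>
        (v * xcomp Omega) ^+ 2 * df (i + 1) j v Omega * ind_neg Omega)].

End kinetic.

(* Main.v *)
Require Import Defs.
From HB Require Import structures.
From mathcomp Require Import all_boot all_order all_algebra.
From mathcomp Require Import all_classical all_reals all_analysis.
From mathcomp Require Import measurable_realfun.
From mathcomp Require Import ring lra.

Set Implicit Arguments.
Unset Strict Implicit.
Unset Printing Implicit Defensive.

Import Order.TTheory GRing.Theory Num.Theory.
Import numFieldNormedType.Exports.

Local Open Scope classical_set_scope.
Local Open Scope ring_scope.

(** With eta = eps the exponent w = - (s / eps^2) dt tends to minus infinity,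
    and 0 <= exp w <= - 1 / w = eps^2 / (s dt).  Hence the coefficients A and
    B, which multiply the terms carrying the kinetic data f and df, tend to 0
    ([cvg_ugks_A], [cvg_ugks_B]), while D tends to - 1 / s ([cvg_ugks_D]).
    The coefficient C_0 blows up like 1 / eps, but it multiplies a moment of
    v Omega_x M(v), which vanishes for every eps because Omega_x has mean zero
    on the sphere ([moment_maxwellian]).  What remains is the term in D.  The
    interface state is the midpoint of the two cell states, so the left and
    right slopes coincide and the two half-spheres recombine into
    v^2 Omega_x^2 times one slope of the Maxwellian, integrated over all
    directions ([cvg_flux]).

    Both reconstructions produce as slope the differential of the Maxwellian
    at some (rho, T) in some direction (drho, dT): the chain rule through
    (q, y) |-> (rho, T) turns the slope in the variables Y into this form
    ([chain_rule_maxwellian_Z], [chain_rule_maxwellian_Y]).  Its moments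
    are those of a Gaussian,
      << v^2 Omega_x^2 dM >>      = T drho + rho dT = d(rho T),
      << v^4 Omega_x^2 dM >> / 2  = 5/2 (T^2 drho + 2 rho T dT)
                                  = 5/2 d(rho T^2),
    which is the limit in the variables Z ([cvg_mass_flux],
    [cvg_energy_flux]).  In the variables Y one has rho T = 2 q / 3 and
    rho T^2 = 4 y / 9, so that these differentials only involve dq and dy
    respectively ([differential_mass], [differential_energy]).

    The angular integrals int Omega_x = 0 and int Omega_x^2 = 4 pi / 3 are
    computed in spherical coordinates, and the radial ones by the recursion
    J (n + 2) = (n + 1) T J n for J n = int_0^oo v^n exp(- v^2 / (2 T)) dv
    ([gauss_momentSS]). *)

(** * Integration over products and against densities *)

Section integrable_real.
Context d (T : measurableType d) (R : realType).
Variables (mu : {measure set T -> \bar R}) (D : set T).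
Hypothesis mD : measurable D.
Implicit Types f g : T -> R.

Lemma integrable_cstM c f : mu.-integrable D (EFin \o f) ->
  mu.-integrable D (EFin \o (fun x => c * f x)).
Proof.
by move=> /(integrableZl mD c); apply: eq_integrable.
Qed.

Lemma integrable_add f g :
  mu.-integrable D (EFin \o f) -> mu.-integrable D (EFin \o g) ->
  mu.-integrable D (EFin \o (fun x => f x + g x)).
Proof.
by move=> fi gi; have := integrableD mD fi gi; apply: eq_integrable.
Qed.
End integrable_real.

Section product_integral.
Context d1 d2 (T1 : measurableType d1) (T2 : measurableType d2) (R : realType).
Variables (m1 : {sigma_finite_measure set T1 -> \bar R})
          (m2 : {sigma_finite_measure set T2 -> \bar R}).
Variables (A : set T1) (B : set T2) (p : T1 -> R) (h : T2 -> R).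
Hypotheses (mA : measurable A) (mB : measurable B).
Hypotheses (ip : m1.-integrable A (EFin \o p))
           (ih : m2.-integrable B (EFin \o h)).

Let pA := p \_ A.
Let hB := h \_ B.

Let ipA : m1.-integrable setT (EFin \o pA).
Proof. by rewrite -restrict_EFin; apply/(integrable_mkcond _ _).1. Qed.

Let ihB : m2.-integrable setT (EFin \o hB).
Proof. by rewrite -restrict_EFin; apply/(integrable_mkcond _ _).1. Qed.

Let patchX : (fun u : T1 * T2 => p u.1 * h u.2) \_ (A `*` B) =
  (fun u => pA u.1 * hB u.2).
Proof.
apply/funext => -[x y]; rewrite /pA /hB !patchE in_setX /=.
by case: (x \in A); case: (y \in B); rewrite /= ?mul0r ?mulr0.
Qed.

Let mprod : measurable_fun setT (fun u : T1 * T2 => pA u.1 * hB u.2).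
Proof.
apply: measurable_funM.
  apply: measurableT_comp measurable_fst.
  by apply/measurable_EFinP; exact: measurable_int ipA.
apply: measurableT_comp measurable_snd.
by apply/measurable_EFinP; exact: measurable_int ihB.
Qed.

Let iprod :
  (m1 \x m2)%E.-integrable setT (EFin \o (fun u : T1 * T2 => pA u.1 * hB u.2)).
Proof.
apply/integrable12ltyP; first exact/measurable_EFinP.
have [mpA pAoo] := integrableP _ _ _ ipA.
have [mhB hBoo] := integrableP _ _ _ ihB.
rewrite (eq_integral (fun x => `|(pA x)%:E| *
    \int[m2]_y `|(hB y)%:E|)%E) => [|x _]; last first.
  rewrite -ge0_integralZl//; last exact: measurableT_comp.
  by apply: eq_integral => y _; rewrite -abseM.
rewrite ge0_integralZr//; last 2 first.
- exact: measurableT_comp.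
- exact: integral_ge0.
rewrite lte_mul_pinfty//; first exact: integral_ge0.
by rewrite ge0_fin_numE//; exact: integral_ge0.
Qed.

Lemma integrable_prodM : (m1 \x m2)%E.-integrable (A `*` B)
  (EFin \o (fun u : T1 * T2 => p u.1 * h u.2)).
Proof.
apply/integrable_mkcond; first exact: measurableX.
by rewrite restrict_EFin patchX.
Qed.

Lemma Rintegral_prodM :
  \int[(m1 \x m2)%E]_(u in A `*` B) (p u.1 * h u.2) =
  (\int[m1]_(x in A) p x) * (\int[m2]_(y in B) h y).
Proof.
rewrite [LHS]Rintegral_mkcond patchX.
rewrite [X in _ = X * _]Rintegral_mkcond [X in _ = _ * X]Rintegral_mkcond.
rewrite [LHS]/Rintegral -integral12_prod_meas1//.
rewrite (_ : fubini_F _ _ = fun x => (pA x)%:E * (\int[m2]_y hB y)%:E)%E.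
  by rewrite integralZr// fineM//; exact: integrable_fin_num.
apply/funext => x; rewrite /fubini_F /= /Rintegral fineK.
  by rewrite -integralZl.
exact: integrable_fin_num.
Qed.
End product_integral.

Section density.
Local Open Scope ereal_scope.
Context d (T : measurableType d) (R : realType).
Variables (nu mu : {measure set T -> \bar R}) (w : T -> R).
Hypotheses (mw : measurable_fun setT w) (w0 : forall x, (0 <= w x)%R).
Hypothesis nuE : forall A, measurable A -> nu A = \int[mu]_(x in A) (w x)%:E.

Import HBNNSimple.

(* By linearity, the case of an indicator function is the hypothesis on nu. *)
Let density_nnsfun (f : {nnsfun T >-> R}) :
  \int[nu]_x (f x)%:E = \int[mu]_x (f x * w x)%:E.
Proof.
under [LHS]eq_integral do rewrite fimfunE -fsumEFin//.
rewrite [LHS]ge0_integral_fsum//; last 2 first.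
- by move=> r; exact/measurable_EFinP/measurableT_comp.
- by move=> n x _; rewrite EFinM nnfun_muleindic_ge0.
under [RHS]eq_integral.
  move=> x xD; rewrite EFinM fimfunE -fsumEFin// ge0_mule_fsuml; last first.
    by move=> r; rewrite EFinM nnfun_muleindic_ge0.
  over.
rewrite [RHS]ge0_integral_fsum//; last 2 first.
- move=> r; apply: emeasurable_funM; last exact/measurable_EFinP.
  exact/measurable_EFinP/measurableT_comp.
- move=> n x _; rewrite mule_ge0 ?lee_fin//.
  by rewrite -lee_fin EFinM nnfun_muleindic_ge0.
apply: eq_fsbigr => r _.
rewrite integralZl_indic_nnsfun// integral_indic// setIT nuE//.
under [RHS]eq_integral do rewrite EFinM -muleA.
have [r0|r0] := leP 0%R r.
  rewrite ge0_integralZl//; last 2 first.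
  - by apply: emeasurable_funM; exact/measurable_EFinP.
  - by move=> x _; rewrite mule_ge0 ?lee_fin.
  congr (_ * _); rewrite [LHS]integral_mkcond; apply: eq_integral => x _.
  by rewrite patchE indicE; case: ifP; rewrite ?mul1e ?mul0e.
rewrite preimage_nnfun0// integral_set0 mule0.
by apply/esym/integral0_eq => x _; rewrite indicE in_set0 mul0e mule0.
Qed.

Let ge0_density (f : T -> \bar R) : measurable_fun setT f ->
  (forall x, 0 <= f x) -> \int[nu]_x f x = \int[mu]_x (f x * (w x)%:E).
Proof.
move=> mf f0.
pose f_ := nnsfun_approx measurableT mf.
transitivity (lim (\int[nu]_x (f_ n x)%:E @[n --> \oo])).
  rewrite -monotone_convergence//=.
  - apply: eq_integral => ? /[!inE] xD; apply/esym/cvg_lim => //=.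
    exact: cvg_nnsfun_approx.
  - by move=> n; exact/measurable_EFinP/measurable_funTS.
  - by move=> n ? _; rewrite lee_fin.
  - by move=> ? _ ? ? mn; rewrite lee_fin; exact/lefP/nd_nnsfun_approx.
under eq_fun do rewrite density_nnsfun.
rewrite -monotone_convergence//=.
- apply: eq_integral => x _; apply/cvg_lim => //=.
  under eq_fun do rewrite EFinM.
  by apply: cvgeMr => //; exact: cvg_nnsfun_approx.
- by move=> n; apply/measurable_EFinP/measurable_funM.
- by move=> n x _; rewrite lee_fin mulr_ge0.
- move=> x _ m n mn; rewrite lee_fin ler_wpM2r//.
  exact/lefP/nd_nnsfun_approx.
Qed.

(** As w is nonnegative, multiplication by w commutes with taking positive
    and negative parts, and both sides are the same difference of integrals of
    nonnegative functions. *)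
Lemma Rintegral_density (f : T -> R) : measurable_fun setT f ->
  (\int[nu]_x f x = \int[mu]_x (f x * w x))%R.
Proof.
move=> mf; congr fine; rewrite integralE [RHS]integralE.
have mEf : measurable_fun setT (EFin \o f) by exact/measurable_EFinP.
congr (_ - _).
- rewrite ge0_density//; last exact: measurable_funepos.
  apply: eq_integral => x _.
  by rewrite !funeposE -!EFin_max -EFinM maxr_pMl// mul0r.
- rewrite ge0_density//; last exact: measurable_funeneg.
  apply: eq_integral => x _.
  by rewrite !funenegE -!EFinN -!EFin_max -EFinM maxr_pMl// mul0r mulNr.
Qed.
End density.

(** * Integrals over the sphere *)

Section sphere.
Context {R : realType}.
Local Notation mu := (@lebesgue_measure R).

(* The angle measure on the product of two copies of the Borel line that
   carries the Lebesgue measure.  Its sigma-algebra is that of R * R, under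
   another display. *)
Let angleR : set (measurableTypeR R * measurableTypeR R) -> \bar R :=
  @angle_measure R.

Let angleR_sigma_additive : semi_sigma_additive angleR.
Proof. exact: (@measure_semi_sigma_additive _ _ _ (@angle_measure R)). Qed.

HB.instance Definition _ := isMeasure.Build _ _ _
  angleR (measure0 (@angle_measure R)) (measure_ge0 (@angle_measure R))
  angleR_sigma_additive.

Let fin_num_angleR : fin_num_fun angleR.
Proof. exact: (@fin_num_angle_measure R). Qed.

HB.instance Definition _ :=
  @Measure_isFinite.Build _ _ R angleR fin_num_angleR.

(** Spherical coordinates: the surface measure is the image under [direction]
    of a measure with density sin theta. *)
Lemma Rintegral_sphere (f : space3 R -> R) :
  measurable_fun setT f -> (exists M, forall x, sphere R x -> `|f x| <= M) ->
  \int[@sphere_measure R]_(x in sphere R) f x =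
  \int[(mu \x mu)%E]_(a in angles R) (f (direction a) * sin a.1).
Proof.
move=> mf [M fM].
have mdir : measurable_fun [set: measurableTypeR R * measurableTypeR R]
    (@direction R).
  exact: measurable_direction.
have fi : angleR.-integrable setT (EFin \o (f \o direction)).
  apply: measurable_bounded_integrable => //.
  - by rewrite ltey_eq fin_num_measure.
  - exact: measurableT_comp.
  - exists M; split; first exact: num_real.
    move=> x Mx a _ /=; apply: le_trans (ltW Mx); apply: fM.
    exact: sphere_direction.
transitivity (\int[angleR]_a f (direction a)).
  rewrite /Rintegral.
  transitivity
    (fine (\int[pushforward angleR direction]_(x in sphere R) (f x)%:E)%E).
    by congr fine; apply: eq_measure_integral.
  rewrite integral_pushforward//=; last 3 first.
  - exact/measurable_EFinP.
  - rewrite (_ : _ @^-1` _ = setT)//; apply/seteqP; split=> // a _.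
    exact: sphere_direction.
  - exact: measurable_sphere.
  congr fine; congr (integral _ _ _); apply/seteqP; split=> // a _.
  exact: sphere_direction.
pose w : measurableTypeR R * measurableTypeR R -> R :=
  (fun a => sin a.1) \_ (angles R).
have w0 a : 0 <= w a.
  rewrite /w patchE; case: ifPn => //; rewrite inE => -[/= + _].
  by rewrite in_itv/= => a1; exact: sin_ge0_pi.
transitivity (\int[(mu \x mu)%E]_a (f (direction a) * w a)).
  apply: (@Rintegral_density _ _ _ angleR (mu \x mu)%E w).
  - apply/measurable_restrict => //; first exact: measurable_angles.
    exact: measurable_sin1.
  - exact: w0.
  - move=> A mA.
    transitivity (\int[mu \x mu]_(a in A `&` angles R) (sin a.1)%:E)%E => //.
    rewrite integral_mkcondr.
    by apply: eq_integral => a _; rewrite restrict_EFin.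
  - exact: measurableT_comp.
rewrite [RHS]Rintegral_mkcond; apply: eq_Rintegral => a _.
by rewrite /w !patchE; case: ifP => //; rewrite mulr0.
Qed.
End sphere.

(** * The fundamental theorem of calculus *)

Section calculus.
Context {R : realType}.
Local Notation mu := (@lebesgue_measure R).
Implicit Types (f F : R -> R) (a b : R).

Lemma is_derive1_continuous f F : (forall x : R, is_derive x (1 : R) F (f x)) ->
  continuous F.
Proof.
move=> dF x; apply/differentiable_continuous/derivable1_diffP.
by have [] := dF x.
Qed.

Lemma continuous_itv_integrable f a b : continuous f ->
  mu.-integrable `[a, b] (EFin \o f).
Proof.
move=> cf; apply: continuous_compact_integrable; first exact: segment_compact.
exact: continuous_subspaceT.
Qed.

Lemma continuous_expr f n : continuous f -> continuous (fun x => f x ^+ n).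
Proof.
move=> cf x; apply: (@continuous_comp _ _ _ f (fun y => y ^+ n)).
  exact: cf.
exact: exprn_continuous.
Qed.

Lemma Rintegral_FTC2 f F a b : a < b -> continuous f ->
  (forall x : R, is_derive x (1 : R) F (f x)) ->
  \int[mu]_(x in `[a, b]) f x = F b - F a.
Proof.
move=> ab cf dF; have cF := is_derive1_continuous dF.
rewrite /Rintegral (continuous_FTC2 ab (F := F))//.
- exact: continuous_subspaceT.
- split.
  + by move=> x _; have [] := dF x.
  + exact/cvg_at_right_filter/cF.
  + exact/cvg_at_left_filter/cF.
- by move=> x _; rewrite derive1E; have [] := dF x.
Qed.

(** The half-line is split at x0: on [0, x0] the integrand may change sign, and
    beyond x0 the primitive F decreases to its limit 0. *)
Lemma Rintegral_FTC2y0 f F x0 : 0 < x0 -> continuous f ->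
  mu.-integrable `[0, +oo[ (EFin \o f) ->
  (forall x, x0 <= x -> f x <= 0) ->
  (forall x : R, is_derive x (1 : R) F (f x)) -> F x @[x --> +oo] --> (0 : R) ->
  \int[mu]_(x in `[0, +oo[) f x = - F 0.
Proof.
move=> x0_gt0 cf fi f_le0 dF Fy; have cF := is_derive1_continuous dF.
have := Rintegral_itvB (x := x0) fi.
rewrite !bnd_simp => /(_ (ltW x0_gt0) isT) /eqP.
rewrite subr_eq => /eqP ->.
rewrite (Rintegral_FTC2 x0_gt0 cf dF) Rintegral_itv_obnd_cbnd; last first.
  apply: integrableS fi => //; apply: subset_itvr.
  by rewrite bnd_simp ltW.
rewrite /Rintegral (le0_continuous_FTC2y (F := F) (l := 0) f_le0)//=.
- by ring.
- exact: continuous_subspaceT.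
- exact/cvg_at_right_filter/cF.
- by move=> x _; rewrite derive1E; have [] := dF x.
Qed.
End calculus.

(** * Angular moments *)

Section sphere_moments.
Context {R : realType}.
Local Notation mu := (@lebesgue_measure R).

Lemma Rintegral_angles (p h : R -> R) : continuous p -> continuous h ->
  \int[(mu \x mu)%E]_(a in angles R) (p a.1 * h a.2) =
  (\int[mu]_(x in `[0, pi]) p x) * (\int[mu]_(x in `[0, pi *+ 2]) h x).
Proof.
move=> cp ch; apply: Rintegral_prodM => //; exact: continuous_itv_integrable.
Qed.

Lemma measurable_xcomp : measurable_fun setT (@xcomp R).
Proof. exact: (measurableT_comp measurable_fst measurable_fst). Qed.

Lemma xcomp_le1 (x : space3 R) : sphere R x -> `|xcomp x| <= 1.
Proof.
rewrite /sphere /xcomp /= => x1; rewrite -(@expr_le1 _ 2)//.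
by rewrite real_normK ?num_real// -x1 -addrA lerDl addr_ge0 ?sqr_ge0.
Qed.

Let pi2_gt0 : 0 < pi *+ 2 :> R.
Proof. by rewrite mulrn_wgt0 ?pi_gt0. Qed.

Lemma Rintegral_sphere_xcomp :
  \int[@sphere_measure R]_(x in sphere R) xcomp x = 0.
Proof.
rewrite Rintegral_sphere; last 2 first.
- exact: measurable_xcomp.
- by exists 1; exact: xcomp_le1.
transitivity (\int[(mu \x mu)%E]_(a in angles R) ((sin a.1 ^+ 2) * cos a.2)).
  by apply: eq_Rintegral => a _; rewrite /xcomp/= expr2 mulrAC.
rewrite (Rintegral_angles (p := fun x => sin x ^+ 2)); last 2 first.
- by apply: continuous_expr; exact: continuous_sin.
- exact: continuous_cos.
rewrite (@Rintegral_FTC2 _ cos sin)//; last exact: continuous_cos.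
by rewrite sin2pi sin0 subrr mulr0.
Qed.

Lemma Rintegral_sphere_xcomp2 :
  \int[@sphere_measure R]_(x in sphere R) xcomp x ^+ 2 = 4 / 3 * pi.
Proof.
rewrite Rintegral_sphere; last 2 first.
- by apply: measurable_funX; exact: measurable_xcomp.
- exists 1 => x /xcomp_le1; rewrite normrX => x1.
  by rewrite exprn_ile1.
transitivity
  (\int[(mu \x mu)%E]_(a in angles R) ((sin a.1 ^+ 3) * cos a.2 ^+ 2)).
  by apply: eq_Rintegral => a _; rewrite /xcomp/=; ring.
rewrite (Rintegral_angles (p := fun x => sin x ^+ 3)
  (h := fun x => cos x ^+ 2)); last 2 first.
- by apply: continuous_expr; exact: continuous_sin.
- by apply: continuous_expr; exact: continuous_cos.
have dsin3 (x : R) : is_derive x (1 : R) (fun x => cos x ^+ 3 / 3 - cos x)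
    (sin x ^+ 3).
  apply: is_derive_eq.
  by rewrite /GRing.scale/= (exprS (sin x) 2) sin2cos2; field.
have dcos2 (x : R) : is_derive x (1 : R) (fun x => (x + sin x * cos x) / 2)
    (cos x ^+ 2).
  apply: is_derive_eq.
  rewrite /GRing.scale/=; have := sin2cos2 x; lra.
rewrite (Rintegral_FTC2 _ _ dsin3) ?pi_gt0//; last first.
  by apply: continuous_expr; exact: continuous_sin.
rewrite (Rintegral_FTC2 _ _ dcos2)//; last first.
  by apply: continuous_expr; exact: continuous_cos.
by rewrite sin2pi sin0 cospi cos0; field.
Qed.
End sphere_moments.

(** * Moments of the Gaussian on the half-line *)

Section gauss.
Context {R : realType}.
Local Notation mu := (@lebesgue_measure R).
Implicit Types T v : R.

Definition gauss T v : R := expR (- v ^+ 2 / (2 * T)).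

Lemma gauss_ge0 T v : 0 <= gauss T v.
Proof. exact: expR_ge0. Qed.

Lemma gauss_le1 T v : 0 < T -> gauss T v <= 1.
Proof.
move=> T0; rewrite -expR0 ler_expR mulNr oppr_le0 divr_ge0 ?sqr_ge0//.
by rewrite mulr_ge0// ltW.
Qed.

Lemma is_derive_gauss T v : T != 0 ->
  is_derive v (1 : R) (gauss T) (- (v / T) * gauss T v).
Proof.
move=> T0; apply: is_derive_eq.
by rewrite /GRing.scale/= /gauss; field.
Qed.

Lemma is_derive_gaussXn T n v : T != 0 ->
  is_derive v (1 : R) (fun x => x ^+ n.+1 * gauss T x)
    (n.+1%:R * v ^+ n * gauss T v - v ^+ n.+2 / T * gauss T v).
Proof.
move=> T0.
have dX : is_derive v (1 : R) (fun x : R => x ^+ n.+1) (n.+1%:R * v ^+ n).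
  rewrite (_ : (fun x => _) = (id : R -> R) ^+ n.+1); last first.
    by rewrite exprfctE.
  by apply: is_derive_eq; rewrite /GRing.scale/= mulr1.
apply: (is_derive_eq (is_deriveM dX (is_derive_gauss v T0))).
by rewrite /GRing.scale/= (exprS v n.+1); field.
Qed.

Lemma continuous_gaussXn T n : 0 < T ->
  continuous (fun v => v ^+ n * gauss T v).
Proof.
move=> T0 v; apply: cvgM; first exact: exprn_continuous.
have /is_derive1_continuous : forall x : R,
    is_derive x (1 : R) (gauss T) (- (x / T) * gauss T x).
  by move=> x; apply: is_derive_gauss; rewrite gt_eqF.
exact.
Qed.

Lemma gaussE T v : 0 < T ->
  gauss T v = Num.sqrt (2 * pi * T) * normal_pdf 0 (Num.sqrt T) v.
Proof.
move=> T0; rewrite normal_pdfE ?gt_eqF ?sqrtr_gt0// /normal_peak.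
rewrite /normal_fun subr0 sqr_sqrtr ?ltW//.
rewrite [in X in _ = X]mulrA (_ : T * pi *+ 2 = 2 * pi * T); last by ring.
rewrite divff ?mul1r /gauss ?mulr_natl//.
by rewrite gt_eqF// sqrtr_gt0 mulr_gt0// mulrn_wgt0// pi_gt0.
Qed.

Lemma integrable_gauss T (D : set (measurableTypeR R)) :
  0 < T -> measurable D ->
  mu.-integrable D (EFin \o gauss T).
Proof.
move=> T0 mD; apply: (@integrableS _ _ _ _ setT) => //.
rewrite (_ : _ \o _ = fun v => ((Num.sqrt (2 * pi * T))%:E *
    (normal_pdf 0 (Num.sqrt T) v)%:E)%E).
  by apply: integrableZl => //; exact: integrable_normal_pdf.
by apply/funext => v /=; rewrite gaussE.
Qed.

Lemma expR_ge_Xn (x : R) n : 0 <= x -> x ^+ n <= n`!%:R * expR x.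
Proof.
move=> x0; case: n => [|n].
  by rewrite expr0 mul1r -expR0 ler_expR.
rewrite mulrC -ler_pdivrMr ?ltr0n ?fact_gt0//.
by apply: le_trans (expR_ge1Dxn n x0); rewrite lerDr.
Qed.

(** Half of the Gaussian decay absorbs the power: with x = v^2 / (4 T), the
    function [gauss T] is exp (- x) times [gauss (2 * T)], and
    x^n <= n! exp x.  A general power is bounded by an even one through
    |t| <= 1 + t^2. *)
Lemma gaussXn_le T n : 0 < T ->
  exists2 C, 0 <= C & forall v, `|v ^+ n * gauss T v| <= C * gauss (2 * T) v.
Proof.
move=> T0; exists (1 + (4 * T) ^+ n * n`!%:R).
  by rewrite addr_ge0// mulr_ge0// exprn_ge0// mulr_ge0// ltW.
move=> v; set x := v ^+ 2 / (4 * T).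
have x0 : 0 <= x by rewrite divr_ge0 ?sqr_ge0// mulr_ge0// ltW.
have -> : gauss T v = expR (- x) * gauss (2 * T) v.
  by rewrite /gauss -expRD; congr expR; rewrite /x; field; rewrite gt_eqF.
rewrite mulrA normrM (ger0_norm (gauss_ge0 _ _)).
apply: ler_wpM2r; first exact: gauss_ge0.
rewrite normrM (ger0_norm (expR_ge0 _)) expRN ler_pdivrMr ?expR_gt0//.
have vn : `|v ^+ n| <= 1 + v ^+ n ^+ 2.
  have := sqr_ge0 (`|v ^+ n| - 1); rewrite sqrrB1 real_normK ?num_real//.
  have := normr_ge0 (v ^+ n); lra.
apply: (le_trans vn); rewrite mulrDl mul1r lerD//.
  by rewrite -expR0 ler_expR.
rewrite -mulrA -exprM mulnC exprM.
have -> : v ^+ 2 = 4 * T * x by rewrite /x; field; rewrite gt_eqF.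
rewrite exprMn ler_wpM2l//.
  by rewrite exprn_ge0// mulr_ge0// ltW.
exact: expR_ge_Xn.
Qed.

Lemma integrable_gaussXn T n (D : set (measurableTypeR R)) :
  0 < T -> measurable D ->
  mu.-integrable D (EFin \o (fun v => v ^+ n * gauss T v)).
Proof.
move=> T0 mD; have [C C0 leC] := gaussXn_le n T0.
have T20 : 0 < 2 * T by rewrite mulr_gt0.
apply: (@le_integrable _ _ _ _ _ mD _
  (fun v => (C%:E * (gauss (2 * T) v)%:E)%E)).
- apply/measurable_EFinP/measurable_funTS.
  by apply: continuous_measurable_fun; exact: continuous_gaussXn.
- move=> v _ /=; rewrite lee_fin (le_trans (leC v))//.
  by rewrite ler_norm.
- by apply: integrableZl => //; exact: integrable_gauss.
Qed.

(** One more power of v is still bounded, so the function is O(1 / v). *)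
Lemma cvg_gaussXn T n : 0 < T -> v ^+ n * gauss T v @[v --> +oo] --> (0 : R).
Proof.
move=> T0; have [C C0 leC] := gaussXn_le n.+1 T0.
apply: (@squeeze_cvgr _ _ _ _ (fun=> 0) (fun v => C * v^-1)).
- near=> v.
  have v0 : 0 < v by near: v; exact: nbhs_pinfty_gt.
  have Xge0 k : 0 <= v ^+ k * gauss T v.
    by rewrite mulr_ge0 ?gauss_ge0// exprn_ge0// ltW.
  rewrite Xge0/= ler_pdivlMr//; have := leC v; rewrite (ger0_norm (Xge0 _)).
  rewrite exprSr mulrAC => /le_trans; apply.
  by rewrite ler_piMr// gauss_le1// mulr_gt0.
- exact: cvg_cst.
- rewrite -[X in _ --> X](mulr0 C); apply: cvgMr.
  apply/gtr0_cvgV0; last exact: cvg_id.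
  exact: nbhs_pinfty_gt.
Unshelve. all: by end_near. Qed.

Definition gauss_moment T n : R :=
  \int[mu]_(v in `[0, +oo[) (v ^+ n * gauss T v).

(** Half of the total mass of a centred normal law of variance T. *)
Lemma gauss_moment0 T : 0 < T -> gauss_moment T 0 = Num.sqrt (2 * pi * T) / 2.
Proof.
move=> T0; have s0 : Num.sqrt T != 0 by rewrite gt_eqF// sqrtr_gt0.
have N := @integral_normal_pdf R 0 (Num.sqrt T).
rewrite ge0_symfun_integralT in N; last 3 first.
- exact: normal_pdf_ge0.
- exact: continuous_normal_pdf.
- move=> x /=; rewrite !normal_pdfE// /normal_fun.
  by rewrite !subr0 sqrrN.
have ->: gauss_moment T 0 = Num.sqrt (2 * pi * T) *
    \int[mu]_(x in `[0, +oo[) normal_pdf 0 (Num.sqrt T) x.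
  rewrite -RintegralZl//.
    by apply: eq_Rintegral => v _; rewrite expr0 mul1r gaussE.
  by apply: (integrableS measurableT) => //; exact: integrable_normal_pdf.
congr (_ * _); rewrite /Rintegral set_itvcy.
case: (integral _ _ _) N => [r| |] //.
- by rewrite -EFinM => -[] /= r2; apply: (@mulfI _ 2); rewrite ?r2 ?divff.
- by rewrite gt0_muley.
- by rewrite gt0_muleNy.
Qed.

(** Integration by parts: f below is the derivative of T v^(n+1) [gauss T],
    which vanishes at both ends of the half-line. *)
Lemma gauss_momentSS T n : 0 < T ->
  gauss_moment T n.+2 = n.+1%:R * T * gauss_moment T n.
Proof.
move=> T0; have Tn0 : T != 0 by rewrite gt_eqF.
have mI : measurable (`[0, +oo[%classic : set (measurableTypeR R)).
  exact: measurable_itv.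
have iXn k := integrable_gaussXn k T0 mI.
pose f v := n.+1%:R * T * (v ^+ n * gauss T v) - v ^+ n.+2 * gauss T v.
have iZ : mu.-integrable `[0, +oo[
    (EFin \o (fun v => n.+1%:R * T * (v ^+ n * gauss T v))).
  by apply: integrable_cstM => //; exact: iXn.
have : \int[mu]_(v in `[0, +oo[) f v = - (T * (0 ^+ n.+1 * gauss T 0)).
  (* f <= 0 as soon as v^2 >= (n + 1) T, in particular for
     v >= 1 + (n + 1) T. *)
  apply: (Rintegral_FTC2y0 (x0 := 1 + n.+1%:R * T)
    (F := fun v => T * (v ^+ n.+1 * gauss T v))).
  - by rewrite addr_gt0// mulr_gt0.
  - move=> v; apply: cvgB; last exact: continuous_gaussXn.
    by apply: cvgMr; exact: continuous_gaussXn.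
  - have := integrableB mI iZ (iXn n.+2).
    by apply: eq_integrable => // v _ /=; rewrite -EFinB.
  - move=> v v0; rewrite /f mulrA -mulrBl exprS exprS mulrA -mulrBl.
    have ? : 0 < n.+1%:R * T by rewrite mulr_gt0.
    rewrite mulr_le0_ge0 ?gauss_ge0// mulr_le0_ge0 ?exprn_ge0//; nra.
  - move=> v; have ? := is_derive_gaussXn n v Tn0; apply: is_derive_eq.
    by rewrite /GRing.scale/= /f; field.
  - rewrite -(mulr0 T); apply: cvgMr; exact: cvg_gaussXn.
rewrite expr0n mul0r mulr0 oppr0 /f (RintegralB mI iZ (iXn n.+2)).
rewrite (RintegralZl _ mI (iXn n)).
by move/eqP; rewrite subr_eq0 => /eqP.
Qed.

End gauss.

(** * Moments of the Maxwellian and of its differential *)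

Section separable.
Context {R : realType}.
Local Notation mu := (@lebesgue_measure R).

(** Fubini for integrands that separate speed and direction; p absorbs the
    weight v^2 of the moments. *)
Lemma moment_separable (g : R -> space3 R -> R) (p : R -> R)
    (h : space3 R -> R) :
  (forall v Omega, moment_integrand g (v, Omega) = p v * h Omega) ->
  mu.-integrable `[0, +oo[ (EFin \o p) ->
  measurable_fun setT h ->
  (exists M, forall x, sphere R x -> `|h x| <= M) ->
  finite_moment g /\
  moment g = (\int[mu]_(v in `[0, +oo[) p v) *
             (\int[@sphere_measure R]_(x in sphere R) h x).
Proof.
move=> gE ip mh [M hM].
have gE' : moment_integrand g = fun u => p u.1 * h u.2.
  by apply/funext => -[v x]; rewrite gE.
have ih : (@sphere_measure R).-integrable (sphere R) (EFin \o h).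
  apply: measurable_bounded_integrable; first exact: measurable_sphere.
  - have := fin_num_sphere_measure (@measurable_sphere R).
    by rewrite fin_numE ltey => /andP[].
  - exact: measurable_funTS.
  - exists M; split; first exact: num_real.
    by move=> x Mx a aS /=; apply: le_trans (ltW Mx); exact: hM.
have mI : measurable (`[0, +oo[%classic : set (measurableTypeR R)).
  exact: measurable_itv.
rewrite /finite_moment /moment gE'; split.
  exact: (integrable_prodM mI (@measurable_sphere R) ip ih).
exact: (Rintegral_prodM mI (@measurable_sphere R) ip ih).
Qed.
End separable.

Section maxwellian.
Context {R : realType}.
Local Notation mu := (@lebesgue_measure R).
Implicit Types (rho T v : R).

Let norm_const T : R := (2 * pi * T) `^ (3 / 2).

Let pi2T_gt0 T : 0 < T -> 0 < 2 * pi * T.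
Proof. by move=> T0; rewrite !mulr_gt0// pi_gt0. Qed.

Let pi_neq0 : pi != 0 :> R.
Proof. by rewrite gt_eqF// pi_gt0. Qed.

Let norm_constE T : 0 < T ->
  norm_const T = 2 * pi * T * Num.sqrt (2 * pi * T).
Proof.
move=> /pi2T_gt0 T0; rewrite /norm_const (_ : 3 / 2 = 1 + 2^-1); last by field.
rewrite powRD; last by rewrite (gt_eqF T0) implybT.
by rewrite powRr1 ?ltW// powR12_sqrt// ltW.
Qed.

Let norm_const_gt0 T : 0 < T -> 0 < norm_const T.
Proof. by move=> /pi2T_gt0; exact: powR_gt0. Qed.

(** The differential of (rho, T) |-> M(v) at (rho, T) in the direction
    (drho, dT), from the logarithmic derivative of exp(- v^2 / (2 T)) / T^(3/2)
    with respect to T. *)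
Definition maxwellian_differential rho T drho dT v : R :=
  (drho + rho * (v ^+ 2 / (2 * T ^+ 2) - 3 / (2 * T)) * dT) *
  maxwellian_Z (1, T) v.

Let is_derive_unit_maxwellian T v : 0 < T ->
  is_derive T (1 : R) (fun b => maxwellian_Z (1, b) v)
    ((v ^+ 2 / (2 * T ^+ 2) - 3 / (2 * T)) * maxwellian_Z (1, T) v).
Proof.
move=> T0; have Tn0 : T != 0 by rewrite gt_eqF.
have P0 := pi2T_gt0 T0.
have nn0 : norm_const T != 0 by rewrite gt_eqF// norm_const_gt0.
have dn : is_derive T (1 : R) norm_const (3 / (2 * T) * norm_const T).
  have dlin : is_derive T (1 : R) (fun b => 2 * pi * b) (2 * pi).
    by apply: is_derive_eq; rewrite /GRing.scale/= mulr1.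
  have := is_derive1_comp (is_derive1_powR (3 / 2) P0) dlin.
  move=> /is_derive_eq; apply; rewrite norm_constE//.
  rewrite (_ : 3 / 2 - 1 = 2^-1); last by field.
  by rewrite powR12_sqrt ?ltW//; field.
have de : is_derive T (1 : R) (fun b => expR (- v ^+ 2 / (2 * b)))
    (v ^+ 2 / (2 * T ^+ 2) * expR (- v ^+ 2 / (2 * T))).
  (* Used by the instance for the inverse of 2 * b. *)
  have T20 : 2 * T != 0 by rewrite mulf_neq0.
  apply: is_derive_eq; rewrite /GRing.scale/=; field.
  by rewrite Tn0.
rewrite /maxwellian_Z /= -/(norm_const T).
have := is_deriveM (is_deriveV nn0 dn) de.
rewrite [X in is_derive _ _ X _](_ : _ =
  fun b => 1 / norm_const b * expR (- v ^+ 2 / (2 * b))); last first.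
  by apply/funext => b; rewrite div1r.
move=> /is_derive_eq; apply; rewrite /GRing.scale/=; field.
by rewrite Tn0 nn0.
Qed.

(** The Maxwellian along a curve (r, t) in the (rho, T) plane.  Both systems of
    variables are covered, since each partial derivative in Y is the derivative
    along such a curve. *)
Lemma is_derive_maxwellian (r t : R -> R) (x dr dt v : R) : 0 < t x ->
  is_derive x (1 : R) r dr -> is_derive x (1 : R) t dt ->
  is_derive x (1 : R) (fun a => maxwellian_Z (r a, t a) v)
    (maxwellian_differential (r x) (t x) dr dt v).
Proof.
move=> tx0 dr' dt'.
have := is_deriveM dr' (is_derive1_comp (is_derive_unit_maxwellian v tx0) dt').
rewrite [X in is_derive _ _ X _](_ : _ =
    fun a => maxwellian_Z (r a, t a) v); last first.
  by apply/funext => a; rewrite /maxwellian_Z /= !mulrA mulr1.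
move=> /is_derive_eq; apply.
by rewrite /GRing.scale/= /maxwellian_differential /=; ring.
Qed.

Lemma chain_rule_maxwellian_Z rho T (h : R * R) v : 0 < T ->
  chain_rule maxwellian_Z (rho, T) h v =
  maxwellian_differential rho T h.1 h.2 v.
Proof.
move=> T0; rewrite /chain_rule !derive1E /=.
have c1 : is_derive rho (1 : R) (fun=> T) 0 by exact: is_derive_cst.
have c2 : is_derive T (1 : R) (fun=> rho) 0 by exact: is_derive_cst.
have i1 : is_derive rho (1 : R) (fun x => x) 1 by exact: is_derive_id.
have i2 : is_derive T (1 : R) (fun x => x) 1 by exact: is_derive_id.
have [_ ->] := is_derive_maxwellian v T0 i1 c1.
have [_ ->] := @is_derive_maxwellian (fun=> rho) id T _ _ v T0 c2 i2.
by rewrite /maxwellian_differential; ring.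
Qed.

(** The direction has components d(q^2 / y) and d(2 y / (3 q)). *)
Lemma chain_rule_maxwellian_Y q y (h : R * R) v : 0 < q -> 0 < y ->
  chain_rule maxwellian_Y (q, y) h v =
  maxwellian_differential (q ^+ 2 / y) (2 * y / (3 * q))
    (2 * q / y * h.1 - q ^+ 2 / y ^+ 2 * h.2)
    (2 / (3 * q) * h.2 - 2 * y / (3 * q ^+ 2) * h.1) v.
Proof.
move=> q0 y0; have qn0 : q != 0 by rewrite gt_eqF.
have yn0 : y != 0 by rewrite gt_eqF.
have TE : 2 * q / (3 * (q ^+ 2 / y)) = 2 * y / (3 * q).
  by field; rewrite qn0 yn0.
have T0 : 0 < 2 * q / (3 * (q ^+ 2 / y)).
  by rewrite TE divr_gt0// mulr_gt0.
(* The instances for inverses find qn0, yn0 and dn0 in the context. *)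
have dn0 : 3 * (q ^+ 2 / y) != 0.
  by rewrite mulf_neq0// mulf_neq0 ?invr_neq0// expf_neq0.
rewrite /chain_rule !derive1E /= /maxwellian_Y /vars_Z_of_Y /=.
have r1 : is_derive q (1 : R) (fun a => a ^+ 2 / y) (2 * q / y).
  by apply: is_derive_eq; rewrite /GRing.scale/=; field.
have iy : is_derive y (1 : R) (fun b => b^-1) (- y ^- 2).
  apply: (is_derive_eq (is_deriveV (f := id) yn0 (is_derive_id _ _))).
  by rewrite /GRing.scale/= mulr1.
have r2 : is_derive y (1 : R) (fun b => q ^+ 2 / b) (- (q ^+ 2 / y ^+ 2)).
  by apply: is_derive_eq; rewrite /GRing.scale/=; field.
have t1 : is_derive q (1 : R) (fun a => 2 * a / (3 * (a ^+ 2 / y)))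
    (- (2 * y / (3 * q ^+ 2))).
  by apply: is_derive_eq; rewrite /GRing.scale/=; field; rewrite qn0 yn0.
have t2 : is_derive y (1 : R) (fun b => 2 * q / (3 * (q ^+ 2 / b)))
    (2 / (3 * q)).
  by apply: is_derive_eq; rewrite /GRing.scale/=; field; rewrite qn0 yn0.
have [_ ->] := is_derive_maxwellian
  (t := fun a => 2 * a / (3 * (a ^+ 2 / y))) v T0 r1 t1.
have [_ ->] := is_derive_maxwellian
  (t := fun b => 2 * q / (3 * (q ^+ 2 / b))) v T0 r2 t2.
by rewrite TE /maxwellian_differential; ring.
Qed.

(** Odd in Omega_x, hence zero. *)
Lemma moment_maxwellian rho T n : 0 < T ->
  let g := fun v Omega =>
    v ^+ n * (v * xcomp Omega * maxwellian_Z (rho, T) v) in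
  finite_moment g /\ moment g = 0.
Proof.
move=> T0 g.
have mI : measurable (`[0, +oo[%classic : set (measurableTypeR R)).
  exact: measurable_itv.
have [] := @moment_separable _ g
  (fun v => rho / norm_const T * (v ^+ n.+3 * gauss T v)) xcomp.
- move=> v Omega.
  rewrite /g /moment_integrand /maxwellian_Z /gauss /norm_const/= !exprS expr0.
  ring.
- by apply: integrable_cstM => //; exact: integrable_gaussXn.
- exact: measurable_xcomp.
- by exists 1; exact: xcomp_le1.
by rewrite Rintegral_sphere_xcomp mulr0.
Qed.

Lemma moment_maxwellian_differential rho T drho dT n : 0 < T ->
  let g := fun v (Omega : space3 R) => v ^+ n *
    ((v * xcomp Omega) ^+ 2 * maxwellian_differential rho T drho dT v) in
  finite_moment g /\
  moment g = 4 / 3 * pi / norm_const T *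
    ((drho - 3 / (2 * T) * rho * dT) * gauss_moment T n.+4 +
     rho * dT / (2 * T ^+ 2) * gauss_moment T n.+4.+2).
Proof.
move=> T0 g.
have Tn0 : T != 0 by rewrite gt_eqF.
have nn0 : norm_const T != 0 by rewrite gt_eqF// norm_const_gt0.
have mI : measurable (`[0, +oo[%classic : set (measurableTypeR R)).
  exact: measurable_itv.
have iXn k := integrable_gaussXn k T0 mI.
pose c0 := (norm_const T)^-1 * (drho - 3 / (2 * T) * rho * dT).
pose c1 := (norm_const T)^-1 * (rho * dT / (2 * T ^+ 2)).
have [] := @moment_separable _ g (fun v => c0 * (v ^+ n.+4 * gauss T v) +
  c1 * (v ^+ n.+4.+2 * gauss T v)) (fun x => xcomp x ^+ 2).
- move=> v Omega; rewrite /moment_integrand /g /maxwellian_differential.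
  rewrite /maxwellian_Z /gauss /= -/(norm_const T) /c0 /c1 !exprS expr0.
  by field; rewrite Tn0 nn0.
- by apply: integrable_add => //; apply: integrable_cstM.
- by apply: measurable_funX; exact: measurable_xcomp.
- by exists 1 => x /xcomp_le1; rewrite normrX => x1; rewrite exprn_ile1.
move=> fg ->; split=> //.
rewrite RintegralD//; [|exact: integrable_cstM..].
rewrite (RintegralZl _ mI (iXn _)) (RintegralZl _ mI (iXn _)).
rewrite -/(gauss_moment T n.+4) -/(gauss_moment T n.+4.+2).
rewrite Rintegral_sphere_xcomp2 /c0 /c1; field.
by rewrite Tn0 nn0.
Qed.

(* The factor Num.sqrt (2 * pi * T) of the Gaussian moments is also a factor of
   the normalization of the Maxwellian, whence values rational in T and pi. *)
Let gauss_moment4 T : 0 < T ->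
  gauss_moment T 4 = norm_const T * (3 * T / (4 * pi)).
Proof.
move=> T0; rewrite norm_constE// (gauss_momentSS 2 T0) (gauss_momentSS 0 T0).
rewrite gauss_moment0//.
(* [field] would unfold pi; it is made a variable beforehand. *)
by move: pi_neq0; move: pi => p p0; field.
Qed.

Let gauss_moment6 T : 0 < T ->
  gauss_moment T 6 = norm_const T * (15 * T ^+ 2 / (4 * pi)).
Proof.
move=> T0; rewrite (gauss_momentSS 4 T0) gauss_moment4//.
by move: pi_neq0; move: pi => p p0; field.
Qed.

Let gauss_moment8 T : 0 < T ->
  gauss_moment T 8 = norm_const T * (105 * T ^+ 3 / (4 * pi)).
Proof.
move=> T0; rewrite (gauss_momentSS 6 T0) gauss_moment6//.
by move: pi_neq0; move: pi => p p0; field.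
Qed.

Lemma moment0_maxwellian_differential rho T drho dT : 0 < T ->
  moment (fun v (Omega : space3 R) => v ^+ 0 *
    ((v * xcomp Omega) ^+ 2 * maxwellian_differential rho T drho dT v)) =
  T * drho + rho * dT.
Proof.
move=> T0; have [_ ->] := moment_maxwellian_differential rho drho dT 0 T0.
rewrite [gauss_moment T 0.+4](gauss_moment4 T0).
rewrite [gauss_moment T 0.+4.+2](gauss_moment6 T0).
have nn0 : norm_const T != 0 by rewrite gt_eqF// norm_const_gt0.
move: nn0 pi_neq0; move: (norm_const T) pi => N p N0 p0.
by field; rewrite p0 (gt_eqF T0) N0.
Qed.

Lemma moment2_maxwellian_differential rho T drho dT : 0 < T ->
  moment (fun v (Omega : space3 R) => v ^+ 2 *
    ((v * xcomp Omega) ^+ 2 * maxwellian_differential rho T drho dT v)) =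
  5 * (T ^+ 2 * drho + 2 * rho * T * dT).
Proof.
move=> T0; have [_ ->] := moment_maxwellian_differential rho drho dT 2 T0.
rewrite [gauss_moment T 2.+4](gauss_moment6 T0).
rewrite [gauss_moment T 2.+4.+2](gauss_moment8 T0).
have nn0 : norm_const T != 0 by rewrite gt_eqF// norm_const_gt0.
move: nn0 pi_neq0; move: (norm_const T) pi => N p N0 p0.
by field; rewrite p0 (gt_eqF T0) N0.
Qed.
End maxwellian.

(** * Linearity of the moments *)

Section moment_linear.
Context {R : realType}.
Implicit Types (g h : R -> space3 R -> R) (c : R).

Let mD : measurable (@velocity_domain R : set (measurableTypeR R * space3 R)).
Proof.
apply: measurableX; last exact: measurable_sphere.
exact: (measurable_itv `[0, +oo[).
Qed.

Lemma finite_momentZ c g : finite_moment g ->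
  finite_moment (fun v Omega => c * g v Omega).
Proof.
move=> gi; have := integrable_cstM mD c gi.
by apply: eq_integrable => // u _ /=; rewrite /moment_integrand mulrA.
Qed.

Lemma finite_momentD g h : finite_moment g -> finite_moment h ->
  finite_moment (fun v Omega => g v Omega + h v Omega).
Proof.
move=> gi hi; have := integrable_add mD gi hi.
by apply: eq_integrable => // u _ /=; rewrite /moment_integrand mulrDl.
Qed.

Lemma momentZ c g : finite_moment g ->
  moment (fun v Omega => c * g v Omega) = c * moment g.
Proof.
move=> gi; rewrite /moment -(RintegralZl _ mD gi).
by apply: eq_Rintegral => u _; rewrite /moment_integrand mulrA.
Qed.

Lemma momentD g h : finite_moment g -> finite_moment h ->
  moment (fun v Omega => g v Omega + h v Omega) = moment g + moment h.
Proof.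
move=> gi hi; rewrite /moment -(RintegralD mD gi hi).
by apply: eq_Rintegral => u _; rewrite /moment_integrand mulrDl.
Qed.

Lemma eq_moment g h : (forall v Omega, g v Omega = h v Omega) ->
  moment g = moment h.
Proof.
by move=> gh; congr moment; apply/funext => v; apply/funext => x; exact: gh.
Qed.

Lemma eq_finite_moment g h : (forall v Omega, g v Omega = h v Omega) ->
  finite_moment g -> finite_moment h.
Proof.
move=> gh; have -> // : g = h.
by apply/funext => v; apply/funext => x; exact: gh.
Qed.
End moment_linear.

(** * Limits of the coefficients *)

Section coefficients.
Context {R : realType}.
Variables (s dt : R).
Hypotheses (s_gt0 : 0 < s) (dt_gt0 : 0 < dt).

(* In these terms w = - 1 / (k eps^2) for eps > 0. *)
Let k : R := (s * dt)^-1.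
Let E (eps : R) := expR (ugks_w eps eps s dt).
Let Q (eps : R) := (1 - E eps) / ugks_w eps eps s dt.

Let k_gt0 : 0 < k.
Proof. by rewrite invr_gt0 mulr_gt0. Qed.

Let wE eps : 0 < eps -> ugks_w eps eps s dt = - (k * eps ^+ 2)^-1.
Proof.
move=> e0; rewrite /ugks_w /k; field.
by rewrite !gt_eqF.
Qed.

(* exp w = 1 / exp(- w) <= 1 / (- w), since exp u >= 1 + u. *)
Let E_bound eps : 0 < eps -> 0 <= E eps <= k * eps ^+ 2.
Proof.
move=> e0; have u0 : 0 < k * eps ^+ 2 by rewrite mulr_gt0// exprn_gt0.
rewrite expR_ge0 /E wE// expRN invf_ple ?posrE ?expR_gt0//.
by rewrite (le_trans _ (expR_ge1Dx _))// lerDr.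
Qed.

Let Q_bound eps : 0 < eps -> 0 <= - Q eps <= k * eps ^+ 2.
Proof.
move=> e0; have u0 : 0 < k * eps ^+ 2 by rewrite mulr_gt0// exprn_gt0.
have /andP[E0 _] := E_bound e0.
have E1 : E eps <= 1.
  by rewrite -expR0 ler_expR wE// oppr_le0 invr_ge0 ltW.
have -> : - Q eps = (1 - E eps) * (k * eps ^+ 2).
  by rewrite /Q wE// invrN invrK mulrN opprK.
rewrite mulr_ge0 ?subr_ge0// ?(ltW u0)//=.
by rewrite ler_piMl ?(ltW u0)// gerBl.
Qed.

Let cvg_eps n c : c * eps ^+ n.+1 @[eps --> (0 : R)^'+] --> (0 : R).
Proof.
have /(_ 0)/cvg_at_right_filter : continuous (fun eps : R => c * eps ^+ n.+1).
  by move=> x; apply: cvgMr; exact: exprn_continuous.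
by rewrite expr0n mulr0.
Qed.

Let cvgE : E eps @[eps --> 0^'+] --> (0 : R).
Proof.
apply: (@squeeze_cvgr _ _ _ _ (fun=> 0) (fun eps => k * eps ^+ 2)).
- by near=> eps; apply: E_bound; near: eps; exact: nbhs_right_gt.
- exact: cvg_cst.
- exact: cvg_eps.
Unshelve. all: by end_near. Qed.

Let cvgQ : Q eps @[eps --> 0^'+] --> (0 : R).
Proof.
have -> : Q = - (fun eps => - Q eps).
  by apply/funext => eps; exact/esym/opprK.
rewrite -[X in _ --> X]oppr0; apply: cvgN.
apply: (@squeeze_cvgr _ _ _ _ (fun=> 0) (fun eps => k * eps ^+ 2)).
- by near=> eps; apply: Q_bound; near: eps; exact: nbhs_right_gt.
- exact: cvg_cst.
- exact: cvg_eps.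
Unshelve. all: by end_near. Qed.

(** The prefactor 1 / eps is compensated by the bound k eps^2 on - Q. *)
Lemma cvg_ugks_A : ugks_A eps eps s dt @[eps --> 0^'+] --> (0 : R).
Proof.
apply: (@squeeze_cvgr _ _ _ _ (fun=> 0) (fun eps => k * eps ^+ 1)).
- near=> eps.
  have e0 : 0 < eps by near: eps; exact: nbhs_right_gt.
  have -> : ugks_A eps eps s dt = - Q eps / eps.
    by rewrite /ugks_A /Q /E /=; ring.
  have /andP[Q0 Qk] := Q_bound e0.
  rewrite divr_ge0 ?(ltW e0)//= ler_pdivrMr//.
  by rewrite expr1 -mulrA -expr2.
- exact: cvg_cst.
- exact: cvg_eps.
Unshelve. all: by end_near. Qed.

Let near_eps (f : R -> R) (l : R) : f eps @[eps --> 0^'+] --> l ->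
  forall g : R -> R, (forall eps, 0 < eps -> f eps = g eps) ->
  g eps @[eps --> 0^'+] --> l.
Proof.
move=> fl g fg; apply: cvg_trans fl; apply: near_eq_cvg; near=> eps.
by apply: fg; near: eps; exact: nbhs_right_gt.
Unshelve. all: by end_near. Qed.

Lemma cvg_ugks_B : ugks_B eps eps s dt @[eps --> 0^'+] --> (0 : R).
Proof.
have H : s^-1 * (E eps + Q eps) @[eps --> 0^'+] --> s^-1 * (0 + 0).
  by apply: cvgMr; apply: cvgD; [exact: cvgE|exact: cvgQ].
rewrite addr0 mulr0 in H; apply: (near_eps H) => eps e0.
rewrite /ugks_B /Q /E /=; congr (_ * _).
by field; rewrite !gt_eqF.
Qed.

Lemma cvg_ugks_D : ugks_D eps eps s dt @[eps --> 0^'+] --> - (1 / s).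
Proof.
have H : - s^-1 * (1 + E eps + 2 * Q eps) @[eps --> 0^'+] -->
    - s^-1 * (1 + 0 + 2 * 0).
  apply: cvgMr; apply: cvgD; last by apply: cvgMr; exact: cvgQ.
  by apply: cvgD; [exact: cvg_cst|exact: cvgE].
rewrite !(mulr0, addr0, mulr1) -div1r in H; apply: (near_eps H) => eps e0.
rewrite /ugks_D /Q /E /=; congr (_ * _).
by field; rewrite !gt_eqF.
Qed.
End coefficients.

(** * The diffusion limit of the fluxes *)

Section flux.
Context {R : realType}.
Variables (dx dt : R) (f df : int -> int -> R -> space3 R -> R).
Variables (sigma : int -> int -> R) (i j : int) (psi : R -> R).
Hypotheses (dt_gt0 : 0 < dt) (s_gt0 : 0 < interface sigma i j).
Variables (M : R * R -> R -> R) (X : int -> int -> R * R).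

Let s := interface sigma i j.

(** The interface state is the midpoint of the two cell states. *)
Lemma slopeL_eq_slopeR : slopeL M X dx i j = slopeR M X dx i j.
Proof.
apply/funext => v; rewrite /slopeL /slopeR; congr chain_rule.
by rewrite /difference_quotient /interface2 /interface /mean/=; congr (_, _);
  congr (_ / _); field.
Qed.

Let fm (g : R -> space3 R -> R) : Prop :=
  finite_moment (fun v Omega => psi v * g v Omega).

Hypotheses
  (f1 : fm (fun v Omega => v * xcomp Omega * f i j v Omega * ind_pos Omega))
  (f2 : fm (fun v Omega =>
     v * xcomp Omega * f (i + 1) j v Omega * ind_neg Omega))
  (d1 : fm (fun v Omega => v * xcomp Omega * df i j v Omega * ind_pos Omega))
  (d2 : fm (fun v Omega =>
     v * xcomp Omega * df (i + 1) j v Omega * ind_neg Omega))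
  (e1 : fm (fun v Omega =>
     (v * xcomp Omega) ^+ 2 * df i j v Omega * ind_pos Omega))
  (e2 : fm (fun v Omega =>
     (v * xcomp Omega) ^+ 2 * df (i + 1) j v Omega * ind_neg Omega))
  (m1 : fm (fun v Omega => v * xcomp Omega * M (interface2 X i j) v))
  (s1 : fm (fun v Omega => (v * xcomp Omega) ^+ 2 * slopeL M X dx i j v)).
Hypothesis m0 :
  moment (fun v Omega =>
    psi v * (v * xcomp Omega * M (interface2 X i j) v)) = 0.

(* The indicators miss only the equator, where Omega_x vanishes. *)
Let xcomp2_ind (x : space3 R) :
  xcomp x ^+ 2 * (ind_pos x + ind_neg x) = xcomp x ^+ 2.
Proof.
rewrite /ind_pos /ind_neg !indicE; have [x0|x0|x0] := ltgtP 0 (xcomp x).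
- rewrite mem_set//= memNset/= ?addr0 ?mulr1// => /lt_trans /(_ x0).
  by rewrite ltxx.
- rewrite memNset/= ?mem_set//= ?add0r ?mulr1// => /lt_trans /(_ x0).
  by rewrite ltxx.
- by rewrite -x0 expr0n mul0r.
Qed.

(** For a fixed weight psi the moment of the flux is A m1 + B m2 + C_0 m3 + D m4
    with moments m1, m2, m3, m4 that do not depend on eps, and m3 = 0. *)
Lemma cvg_flux :
  moment (fun v Omega =>
      psi v * micro_flux eps eps dx dt f df sigma M X i j v Omega)
    @[eps --> 0^'+] -->
  - (1 / s) * moment (fun v Omega =>
      psi v * ((v * xcomp Omega) ^+ 2 * slopeL M X dx i j v)).
Proof.
pose h1 := fun v Omega => psi v *
  (v * xcomp Omega * f i j v Omega * ind_pos Omega) +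
  dx / 2 * (psi v * (v * xcomp Omega * df i j v Omega * ind_pos Omega)) +
  (psi v * (v * xcomp Omega * f (i + 1) j v Omega * ind_neg Omega) +
   - (dx / 2) *
     (psi v * (v * xcomp Omega * df (i + 1) j v Omega * ind_neg Omega))).
pose h2 := fun v Omega => psi v *
  ((v * xcomp Omega) ^+ 2 * df i j v Omega * ind_pos Omega) + psi v *
  ((v * xcomp Omega) ^+ 2 * df (i + 1) j v Omega * ind_neg Omega).
pose h3 := fun v Omega => psi v * (v * xcomp Omega * M (interface2 X i j) v).
pose h4 := fun v Omega => psi v *
  ((v * xcomp Omega) ^+ 2 * slopeL M X dx i j v).
have i1 : finite_moment h1.
  by apply: finite_momentD; apply: finite_momentD => //; exact: finite_momentZ.
have i2 : finite_moment h2 by exact: finite_momentD.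
have i3 : finite_moment h3 by exact: m1.
have i4 : finite_moment h4 by exact: s1.
have fluxE eps : moment (fun v Omega =>
    psi v * micro_flux eps eps dx dt f df sigma M X i j v Omega) =
    ugks_A eps eps s dt * moment h1 + ugks_B eps eps s dt * moment h2 +
    ugks_D eps eps s dt * moment h4.
  set A := ugks_A _ _ _ _; set B := ugks_B _ _ _ _; set D := ugks_D _ _ _ _.
  pose C := ugks_C eps eps s dt.
  transitivity (moment (fun v Omega => A * h1 v Omega + B * h2 v Omega +
      (C * h3 v Omega + D * h4 v Omega))).
    apply: eq_moment => v x; rewrite /micro_flux -/s -/A -/B -/C -/D.
    rewrite -slopeL_eq_slopeR -mulrDr.
    rewrite [in X in D * X * _]exprMn.
    rewrite (_ : D * _ * _ = D * (v ^+ 2 * (xcomp x ^+ 2 *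
      (ind_pos x + ind_neg x)) * slopeL M X dx i j v)); last by ring.
    rewrite xcomp2_ind /h1 /h2 /h3 /h4; ring.
  have zA := finite_momentZ A i1; have zB := finite_momentZ B i2.
  have zC := finite_momentZ C i3; have zD := finite_momentZ D i4.
  rewrite (momentD (finite_momentD zA zB) (finite_momentD zC zD)).
  rewrite (momentD zA zB) (momentD zC zD) !momentZ// [moment h3]m0.
  by rewrite mulr0 add0r.
under eq_fun do rewrite fluxE.
have cA := cvg_ugks_A s_gt0 dt_gt0.
have cB := cvg_ugks_B s_gt0 dt_gt0.
have cD := cvg_ugks_D s_gt0 dt_gt0.
suff : ugks_A eps eps s dt * moment h1 + ugks_B eps eps s dt * moment h2 +
    ugks_D eps eps s dt * moment h4 @[eps --> 0^'+] -->
    0 * moment h1 + 0 * moment h2 + - (1 / s) * moment h4.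
  by rewrite !mul0r !add0r.
by apply: cvgD; [apply: cvgD|]; apply: cvgMl.
Qed.
End flux.

Section diffusion_limit.
Context {R : realType}.
Variables (dx dt : R) (f df : int -> int -> R -> space3 R -> R).
Variables (sigma : int -> int -> R) (i j : int).
Hypotheses (dt_gt0 : 0 < dt) (s_gt0 : 0 < interface sigma i j).
Hypothesis f_moments : finite_flux_moments f df i j.
Variables (M : R * R -> R -> R) (X : int -> int -> R * R).
Variables (rho T drho dT : R).
Hypothesis T_gt0 : 0 < T.
Hypothesis ME : M (interface2 X i j) = maxwellian_Z (rho, T).
Hypothesis slopeE :
  slopeL M X dx i j = maxwellian_differential rho T drho dT.

Let s := interface sigma i j.
Let flux eps := macro_flux eps eps dx dt f df sigma M X i j.

(* The two components of Psi are multiples of powers of v: c = 1, n = 0 and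
   c = 1 / 2, n = 2. *)
Let cvg_weighted_flux (psi : R -> R) c n :
  (forall v, psi v = c * v ^+ n) ->
  let fm := fun g : R -> space3 R -> R =>
    finite_moment (fun v Omega => psi v * g v Omega) in
  fm (fun v Omega => v * xcomp Omega * f i j v Omega * ind_pos Omega) ->
  fm (fun v Omega => v * xcomp Omega * f (i + 1) j v Omega * ind_neg Omega) ->
  fm (fun v Omega => v * xcomp Omega * df i j v Omega * ind_pos Omega) ->
  fm (fun v Omega => v * xcomp Omega * df (i + 1) j v Omega * ind_neg Omega) ->
  fm (fun v Omega =>
    (v * xcomp Omega) ^+ 2 * df i j v Omega * ind_pos Omega) ->
  fm (fun v Omega =>
    (v * xcomp Omega) ^+ 2 * df (i + 1) j v Omega * ind_neg Omega) ->
  moment (fun v Omega =>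
      psi v * micro_flux eps eps dx dt f df sigma M X i j v Omega)
    @[eps --> 0^'+] -->
  - (1 / s) * (c * moment (fun v Omega => v ^+ n *
    ((v * xcomp Omega) ^+ 2 * maxwellian_differential rho T drho dT v))).
Proof.
move=> psiE fm a1 a2 b1 b2 c1 c2.
have [fin1 m1] := moment_maxwellian rho n T_gt0.
have [fin2 _] := moment_maxwellian_differential rho drho dT n T_gt0.
have E1 v x : c * (v ^+ n * (v * xcomp x * maxwellian_Z (rho, T) v)) =
    psi v * (v * xcomp x * M (interface2 X i j) v).
  by rewrite psiE ME mulrA.
have E2 v x : c * (v ^+ n * ((v * xcomp x) ^+ 2 *
    maxwellian_differential rho T drho dT v)) =
    psi v * ((v * xcomp x) ^+ 2 * slopeL M X dx i j v).
  by rewrite psiE slopeE mulrA.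
rewrite -(momentZ c fin2) (eq_moment E2); apply: cvg_flux => //.
- exact: eq_finite_moment E1 (finite_momentZ c fin1).
- exact: eq_finite_moment E2 (finite_momentZ c fin2).
- by rewrite -(eq_moment E1) momentZ// m1 mulr0.
Qed.

Lemma cvg_mass_flux :
  (flux eps).1 @[eps --> 0^'+] --> - (1 / s) * (T * drho + rho * dT).
Proof.
have [[[? _] [? _]] [[? _] [? _]] [[? _] [? _]]] := f_moments.
rewrite -(moment0_maxwellian_differential rho drho dT T_gt0).
rewrite -[X in _ * X]mul1r.
apply: (@cvg_weighted_flux (fun v => (Psi v).1)) => // v.
by rewrite mul1r.
Qed.

Lemma cvg_energy_flux :
  (flux eps).2 @[eps --> 0^'+] -->
  - (5 / (2 * s)) * (T ^+ 2 * drho + 2 * rho * T * dT).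
Proof.
have [[[_ ?] [_ ?]] [[_ ?] [_ ?]] [[_ ?] [_ ?]]] := f_moments.
rewrite (_ : - (5 / (2 * s)) * _ =
  - (1 / s) * (2^-1 * (5 * (T ^+ 2 * drho + 2 * rho * T * dT)))); last first.
  by field; rewrite gt_eqF.
rewrite -(moment2_maxwellian_differential rho drho dT T_gt0).
apply: (@cvg_weighted_flux (fun v => (Psi v).2)) => // v.
by rewrite mulrC.
Qed.
End diffusion_limit.

(** * From (q, y) to (rho, T) *)

Lemma vars_Z_of_YE (R : realType) (q y : R) : 0 < q -> 0 < y ->
  vars_Z_of_Y (q, y) = (q ^+ 2 / y, 2 * y / (3 * q)).
Proof.
move=> q0 y0; rewrite /vars_Z_of_Y /=; congr (_, _).
by field; rewrite !gt_eqF.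
Qed.

(** With rho = q^2 / y and T = 2 y / (3 q), one has rho T = 2 q / 3;
    the left-hand side is d(rho T) in the direction (dq, dy). *)
Lemma differential_mass (R : realType) (q y dq dy : R) : 0 < q -> 0 < y ->
  2 * y / (3 * q) * (2 * q / y * dq - q ^+ 2 / y ^+ 2 * dy) +
  q ^+ 2 / y * (2 / (3 * q) * dy - 2 * y / (3 * q ^+ 2) * dq) = 2 / 3 * dq.
Proof. by move=> q0 y0; field; rewrite !gt_eqF. Qed.

(** With rho = q^2 / y and T = 2 y / (3 q), one has rho T^2 = 4 y / 9;
    the left-hand side is d(rho T^2) in the direction (dq, dy). *)
Lemma differential_energy (R : realType) (q y dq dy : R) : 0 < q -> 0 < y ->
  (2 * y / (3 * q)) ^+ 2 * (2 * q / y * dq - q ^+ 2 / y ^+ 2 * dy) +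
  2 * (q ^+ 2 / y) * (2 * y / (3 * q)) *
    (2 / (3 * q) * dy - 2 * y / (3 * q ^+ 2) * dq) = 4 / 9 * dy.
Proof. by move=> q0 y0; field; rewrite !gt_eqF. Qed.

Theorem mainTheorem3 (R : realType) (dx dy dt : R)
    (f df : int -> int -> R -> space3 R -> R)
    (rho T sigma : int -> int -> R) (i j : int)
    (dx_gt0 : 0 < dx) (dy_gt0 : 0 < dy) (dt_gt0 : 0 < dt)
    (rho_gt0 : forall k l : int, 0 < rho k l)
    (T_gt0 : forall k l : int, 0 < T k l)
    (sigma_gt0 : 0 < interface sigma i j)
    (f_moments : finite_flux_moments f df i j) :
  let Z := fun k l : int => (rho k l, T k l) in
  let Y := fun k l : int => vars_Y (rho k l) (T k l) in
  let q := fun k l : int => (Y k l).1 in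
  let y := fun k l : int => (Y k l).2 in
  let PhiZ := fun eps : R =>
    macro_flux eps eps dx dt f df sigma maxwellian_Z Z i j in
  let PhiY := fun eps : R =>
    macro_flux eps eps dx dt f df sigma maxwellian_Y Y i j in
  let s := interface sigma i j in
  let rhoI := interface rho i j in
  let TI := interface T i j in
  ((PhiZ eps).1 @[eps --> 0^'+] -->
      - (1 / s) * (TI * ((rho (i + 1) j - rho i j) / dx) +
                   rhoI * ((T (i + 1) j - T i j) / dx)) /\
   (PhiZ eps).2 @[eps --> 0^'+] -->
      - (5 / (2 * s)) * (TI ^+ 2 * ((rho (i + 1) j - rho i j) / dx) +
                         2 * rhoI * TI * ((T (i + 1) j - T i j) / dx))) /\
  ((PhiY eps).1 @[eps --> 0^'+] -->
      - (2 / (3 * s)) * ((q (i + 1) j - q i j) / dx) /\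
   (PhiY eps).2 @[eps --> 0^'+] -->
      - (5 / 3) * (2 / (3 * s)) * ((y (i + 1) j - y i j) / dx)).
Proof.
move=> Z Y q y PhiZ PhiY s rhoI TI.
have mean_gt0 (a b : R) : 0 < a -> 0 < b -> 0 < mean a b.
  by move=> a0 b0; rewrite divr_gt0// addr_gt0.
have sn0 : s != 0 by rewrite gt_eqF.
have dxn0 : dx != 0 by rewrite gt_eqF.
have TI0 : 0 < TI by exact: mean_gt0.
have q_gt0 k l : 0 < q k l by rewrite !mulr_gt0.
have y_gt0 k l : 0 < y k l by rewrite divr_gt0// exprn_gt0// q_gt0.
have qI0 : 0 < interface q i j by exact: mean_gt0.
have yI0 : 0 < interface y i j by exact: mean_gt0.
have half (a b : R) : ((a + b) / 2 - a) / (dx / 2) = (b - a) / dx by field.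
have slopeZ : slopeL maxwellian_Z Z dx i j = maxwellian_differential rhoI TI
    ((rho (i + 1) j - rho i j) / dx) ((T (i + 1) j - T i j) / dx).
  apply/funext => v.
  by rewrite /slopeL chain_rule_maxwellian_Z// /difference_quotient/= !half.
pose qI := interface q i j; pose yI := interface y i j.
pose dq := (q (i + 1) j - q i j) / dx; pose dY := (y (i + 1) j - y i j) / dx.
have slopeY : slopeL maxwellian_Y Y dx i j =
    maxwellian_differential (qI ^+ 2 / yI) (2 * yI / (3 * qI))
      (2 * qI / yI * dq - qI ^+ 2 / yI ^+ 2 * dY)
      (2 / (3 * qI) * dY - 2 * yI / (3 * qI ^+ 2) * dq).
  apply/funext => v; rewrite /slopeL.
  rewrite (chain_rule_maxwellian_Y _ _ qI0 yI0) /difference_quotient/=.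
  by rewrite !half.
have TY0 : 0 < 2 * yI / (3 * qI).
  by rewrite divr_gt0// mulr_gt0.
have MY : maxwellian_Y (interface2 Y i j) =
    maxwellian_Z (qI ^+ 2 / yI, 2 * yI / (3 * qI)).
  by rewrite -vars_Z_of_YE.
split; split.
- exact: cvg_mass_flux slopeZ.
- exact: cvg_energy_flux slopeZ.
- rewrite (_ : - _ * _ = - (1 / s) * (2 / 3 * dq)).
    rewrite -(differential_mass dq dY qI0 yI0).
    exact: cvg_mass_flux MY slopeY.
  by rewrite -/dq; move: (dq) (s) sn0 => d e e0; field.
- rewrite (_ : - (5 / 3) * _ * _ = - (5 / (2 * s)) * (4 / 9 * dY)).
    rewrite -(differential_energy dq dY qI0 yI0).
    exact: cvg_energy_flux MY slopeY.
  by rewrite -/dY; move: (dY) (s) sn0 => d e e0; field.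
Qed.
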